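(* For every integer $q \geq 2$, the limit defining the constant $C_q = \inf_{n \geq 1} \sqrt[n]{f(n,q)}$ satisfies $f(n,q) = C_q^{(1+o(1))n}$ as $n \to \infty$. Moreover, the sequence $(C_q)_{q \geq 2}$ is non-increasing.
   Context: For integers $n \geq 1$ and $q \geq 2$, let $\mathbb Z_q = \mathbb Z/q\mathbb Z$ and consider $\mathbb Z_q^n$ with the Hamming distance $d(x,y)$ = number of coordinates in which $x$ and $y$ differ. Say $x$ skirts $y$ if $d(x,y) = n$ (i.e. $x$ and $y$ differ in every coordinate). A set $S \subseteq \mathbb Z_q^n$ is a skirting set if every $y \in \mathbb Z_q^n$ is skirted by some $x \in S$. Let $f(n,q)$ denote the minimum size of a skirting set in $\mathbb Z_q^n$. The notation $g(n) = o(h(n))$ means $\lim_{n\to\infty} g(n)/h(n) = 0$. *)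

(* Defs.v *)
From HB Require Import structures.
From mathcomp Require Import all_boot all_order all_algebra.
From mathcomp Require Import all_classical all_reals all_analysis.
Set Implicit Arguments.
Unset Strict Implicit.
Unset Printing Implicit Defensive.
Import Order.TTheory GRing.Theory Num.Theory.
Import numFieldNormedType.Exports.
Local Open Scope classical_set_scope.
Local Open Scope ring_scope.

(* ['Z_q] is Z/qZ only for [1 < q]; for [q <= 1] it is Z/2Z. *)

Definition hamming (n q : nat) (x y : 'rV['Z_q]_n) : nat :=
  #|[set i : 'I_n | x 0 i != y 0 i]%SET|.

Definition skirts (n q : nat) (x y : 'rV['Z_q]_n) : bool :=
  hamming x y == n.

Definition skirting_set (n q : nat) (S : {set 'rV['Z_q]_n}) : bool :=
  [forall y, exists x in S, skirts x y].

(* The whole space is a skirting set ([skirting_setT]), so this is the minimum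
   over skirting sets ([skirting_num_spec]). *)
Definition skirting_num (n q : nat) : nat :=
  #|[arg min_(S < [set: 'rV['Z_q]_n]%SET | skirting_set S) #|S|]|.

Lemma skirting_setT (n q : nat) : skirting_set [set: 'rV['Z_q]_n]%SET.
Proof.
apply/forallP => y; apply/existsP; exists (\row_i (y 0 i + 1)).
rewrite finset.in_setT /skirts /hamming /=.
suff -> : [set i : 'I_n | (\row_j (y 0 j + 1)) 0 i != y 0 i]%SET
          = [set: 'I_n]%SET by rewrite cardsT card_ord.
apply/setP => i; rewrite !inE mxE -subr_eq0 addrC addKr; exact: oner_neq0.
Qed.

Lemma skirting_num_spec (n q : nat) :
  (exists2 S : {set 'rV['Z_q]_n}, skirting_set S & #|S| = skirting_num n q) /\
  (forall S : {set 'rV['Z_q]_n}, skirting_set S -> (skirting_num n q <= #|S|)%N).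
Proof.
rewrite /skirting_num; case: arg_minnP => [|S sS minS].
  exact: skirting_setT.
by split; [exists S | exact: minS].
Qed.

Definition skirting_root (R : realType) (n q : nat) : R :=
  (skirting_num n q)%:R `^ (n%:R^-1).

Definition skirting_const (R : realType) (q : nat) : R :=
  inf [set skirting_root R n q | n in [set n : nat | (1 <= n)%N]].

Definition is_little_o (R : realType) (g h : nat -> R) : Prop :=
  g n / h n @[n --> \oo] --> (0 : R).

(* Main.v *)
Require Import Defs.
From HB Require Import structures.
From mathcomp Require Import all_boot all_order all_algebra.
From mathcomp Require Import all_classical all_reals all_analysis.
Set Implicit Arguments.
Unset Strict Implicit.
Unset Printing Implicit Defensive.
Import Order.TTheory GRing.Theory Num.Theory.
Import numFieldNormedType.Exports.
Local Open Scope classical_set_scope.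
Local Open Scope ring_scope.

(** The product of two skirting sets is skirting, so [ln f(n,q)] is subadditive
    in [n] and Fekete's lemma makes [ln f(n,q) / n] converge to its infimum [l];
    exponentiating, [C_q = exp l].  A point skirts exactly [(q-1)^n] points, so
    [f(n,q) >= (q/(q-1))^n] and [C_q > 1], which is what allows [f(n,q)] to be
    written as a power of [C_q].  Monotonicity in [q] comes from embedding
    [Z_q] into [Z_q'] with a left inverse. *)

(** Fix [m] with [u m / m] close to the infimum and divide [n] by [m] with remainder: [u n] is at
    most [n %/ m] copies of [u m] plus a remainder term, whose share vanishes after division by
    [n]. *)
Lemma fekete (R : realType) (u : nat -> R) :
  (forall n, 0 <= u n) -> (forall m n, u (m + n)%N <= u m + u n) ->
  u n / n%:R @[n --> \oo] -->
    inf [set u n / n%:R | n in [set n : nat | (1 <= n)%N]].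
Proof.
move=> u0 uD; set E := (X in inf X).
have lbE : has_lbound E.
  by exists 0 => _ [n _ <-]; rewrite divr_ge0.
have E0 : E !=set0 by exists (u 1%N / 1); exists 1%N.
have uMD m k r : u (k * m + r)%N <= k%:R * u m + u r.
  elim: k => [|k IH]; first by rewrite mul0n add0n mul0r add0r.
  by rewrite mulSn -addnA (le_trans (uD _ _))// -natr1 mulrDl mul1r addrAC
    [leRHS]addrC lerD2l.
apply/cvgrPdist_lt => e e0.
have [_ [m m1 <-] um] : exists2 y, E y & y < inf E + e / 2.
  by apply: inf_lt => //; rewrite ltrDl divr_gt0.
have mR : 0 < m%:R :> R by rewrite ltr0n.
(* As all terms are nonnegative, this sum bounds [u r] for every remainder [r < m], independently of
   [n]. *)
pose M := \sum_(i < m) u i.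
have M0 : 0 <= M by apply: sumr_ge0.
near=> n.
have n1 : (1 <= n)%N by near: n; exact: nbhs_infty_ge.
have nR : 0 < n%:R :> R by rewrite ltr0n.
have Mn : M / n%:R < e / 2.
  rewrite ltr_pdivrMr// mulrC -ltr_pdivrMr ?divr_gt0//.
  by near: n; exact: nbhs_infty_gtr.
have infn : inf E <= u n / n%:R by apply: ge_inf => //; exists n.
rewrite ler0_norm ?subr_le0// opprB ltrBlDr.
suff : u n / n%:R <= u m / m%:R + M / n%:R.
  move=> /le_lt_trans; apply.
  by rewrite addrC [e]splitr -addrA ltrD// addrC.
have urM : u (n %% m)%N <= M.
  have rm : (n %% m < m)%N by rewrite ltn_mod.
  by rewrite /M (bigD1 (Ordinal rm))//= lerDl sumr_ge0.
rewrite ler_pdivrMr// mulrDl divfK ?gt_eqF//.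
(* The quotient part is at most [u m / m * n], because [(n %/ m) * m <= n] and [u m] is
   nonnegative. *)
rewrite {1}(divn_eq n m) (le_trans (uMD _ _ _))// lerD//.
rewrite [leLHS]mulrC -mulrA ler_wpM2l//.
by rewrite ler_pdivlMl// mulrC -natrM ler_nat leq_divM.
Unshelve. all: by end_near.
Qed.

Lemma skirtsP (n q : nat) (x y : 'rV['Z_q]_n) :
  reflect (forall i, x 0 i != y 0 i) (skirts x y).
Proof.
rewrite /skirts /hamming; set A := [set i | _]%SET.
have -> : (#|A| == n) = (A == [set: 'I_n]%SET).
  rewrite eqEcard finset.subsetT cardsT card_ord eqn_leq.
  by have := max_card A; rewrite card_ord => ->.
apply: (iffP eqP) => [/setP AT i|xy]; first by have := AT i; rewrite !inE.
by apply/setP => i; rewrite !inE xy.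
Qed.

Lemma skirting_setP (n q : nat) (S : {set 'rV['Z_q]_n}) :
  reflect (forall y : 'rV_n,
             exists2 x : 'rV_n, x \in S & forall i, x 0 i != y 0 i)
    (skirting_set S).
Proof.
apply: (iffP forallP) => H y.
  by have /existsP[x /andP[xS /skirtsP xy]] := H y; exists x.
by have [x xS /skirtsP xy] := H y; apply/existsP; exists x; rewrite xS.
Qed.

Lemma skirting_num_submult (m n q : nat) :
  (skirting_num (m + n) q <= skirting_num m q * skirting_num n q)%N.
Proof.
have [[S /skirting_setP sS <-] _] := skirting_num_spec m q.
have [[T /skirting_setP sT <-] _] := skirting_num_spec n q.
have [_ min_mn] := skirting_num_spec (m + n) q.
pose P := [set row_mx z.1 z.2 | z in finset.setX S T]%SET.
apply: (@leq_trans #|P|); last by rewrite -cardsX leq_imset_card.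
apply/min_mn/skirting_setP => y.
have [x xS xy] := sS (lsubmx y); have [z zT zy] := sT (rsubmx y).
exists (row_mx x z).
  by apply/imsetP; exists (x, z) => //; rewrite inE /= xS zT.
move=> i; case: (split_ordP i) => j ->; rewrite ?row_mxEl ?row_mxEr.
  by have := xy j; rewrite mxE.
by have := zy j; rewrite mxE.
Qed.

(** Translation by [- x] sends the skirted points injectively to functions with values in the [q.-1]
    nonzero residues. *)
Lemma card_skirted (n q : nat) (x : 'rV['Z_q]_n) : (1 < q)%N ->
  (#|[set y | skirts x y]%SET| <= q.-1 ^ n)%N.
Proof.
move=> q1; pose f (y : 'rV['Z_q]_n) := [ffun i => y 0 i - x 0 i].
have f_inj : injective f.
  move=> y z /ffunP fyz; apply/rowP => i.
  by have := fyz i; rewrite !ffunE => /addIr.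
have cardZ : #|predC1 (0 : 'Z_q)| = q.-1 by rewrite cardC1 card_ord Zp_cast.
rewrite -(card_imset _ f_inj) -cardZ -[in leqRHS](card_ord n) -card_ffun_on.
apply/subset_leq_card/fintype.subsetP => _ /imsetP[y + ->].
rewrite inE => /skirtsP xy.
by apply/ffun_onP => i; rewrite ffunE inE subr_eq0 eq_sym.
Qed.

(** Union bound: the sets of points skirted by the elements of a minimum skirting set cover the
    whole space. *)
Lemma skirting_num_lower (n q : nat) : (1 < q)%N ->
  (q ^ n <= skirting_num n q * q.-1 ^ n)%N.
Proof.
move=> q1; have [[S /skirting_setP sS <-] _] := skirting_num_spec n q.
have <- : #|[set: 'rV['Z_q]_n]%SET| = (q ^ n)%N.
  by rewrite cardsT card_mx card_ord Zp_cast// mul1n.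
rewrite -sum_nat_const.
apply: (@leq_trans (\sum_(x in S) #|[set y | skirts x y]%SET|)%N); last first.
  by apply: leq_sum => x _; exact: card_skirted.
apply: (@leq_trans #|\bigcup_(x in S) [set y | skirts x y]%SET|%SET).
  apply/subset_leq_card/fintype.subsetP => y _.
  have [x xS /skirtsP xy] := sS y.
  by apply/finset.bigcupP; exists x; rewrite ?inE.
elim/big_ind2: _ => [|A a B b Aa Bb|//]; first by rewrite cards0.
by rewrite (leq_trans (leq_card_setU _ _))// leq_add.
Qed.

Lemma skirting_num_gt0 (n q : nat) : (0 < skirting_num n q)%N.
Proof.
have [[S /skirting_setP sS <-] _] := skirting_num_spec n q.
by have [x xS _] := sS 0; apply/card_gt0P; exists x.
Qed.

(** Push a skirting set forward along [f], which keeps representatives and need not be additive.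
    Given [y], take [x] skirting its image under [g]: if [f x_i = y_i], then applying [g] gives
    [x_i = g y_i], a contradiction. *)
Lemma skirting_num_anti (n q q' : nat) : (1 < q)%N -> (q <= q')%N ->
  (skirting_num n q' <= skirting_num n q)%N.
Proof.
move=> q1 qq'; have [[S /skirting_setP sS <-] _] := skirting_num_spec n q.
have [_ min_q'] := skirting_num_spec n q'.
pose f (a : 'Z_q) : 'Z_q' := inZp a; pose g (b : 'Z_q') : 'Z_q := inZp b.
have fK : cancel f g.
  move=> a; apply: val_inj => /=.
  rewrite (@modn_small _ (Zp_trunc q').+2) ?modn_small ?ltn_ord//.
  by rewrite (leq_trans (ltn_ord a))// !Zp_cast// (leq_trans q1).
apply: leq_trans (leq_imset_card (map_mx f) (mem S)).
apply/min_q'/skirting_setP => y; have [x xS xy] := sS (map_mx g y).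
exists (map_mx f x); first by apply/imsetP; exists x.
move=> i; have := xy i; rewrite !mxE; apply: contra_neq => <-.
by rewrite fK.
Qed.

Lemma skirting_rootE (R : realType) (n q : nat) :
  skirting_root R n q = expR (ln (skirting_num n q)%:R / n%:R).
Proof.
by rewrite /skirting_root /powR pnatr_eq0 gtn_eqF ?skirting_num_gt0// mulrC.
Qed.

(** The bound is positive and independent of [n], so it survives in the infimum. *)
Lemma ln_skirting_num_lower (R : realType) (n q : nat) :
  (1 < q)%N -> (0 < n)%N ->
  ln (q%:R / q.-1%:R) <= ln (skirting_num n q)%:R / n%:R :> R.
Proof.
move=> q1 n0.
have q0 : (0 < q)%N by exact: ltnW.
have q'0 : (0 < q.-1)%N by rewrite -subn1 subn_gt0.
have := skirting_num_lower n q1.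
rewrite -(ler_nat R) natrM !natrX ler_pdivlMr ?ltr0n// => le_q.
rewrite mulr_natr -lnXn ?divr_gt0 ?ltr0n//.
rewrite ler_ln ?posrE ?exprn_gt0 ?divr_gt0 ?ltr0n ?skirting_num_gt0//.
by rewrite expr_div_n ler_pdivrMr// exprn_gt0// ltr0n.
Qed.

Lemma ln_skirting_num_cvg (R : realType) (q : nat) :
  ln (skirting_num n q)%:R / n%:R @[n --> \oo] -->
    inf [set (ln (skirting_num n q)%:R / n%:R : R)
         | n in [set n : nat | (1 <= n)%N]].
Proof.
apply: (@fekete R (fun n => ln (skirting_num n q)%:R)) => [n|m n].
  by rewrite ln_ge0// ler1n skirting_num_gt0.
rewrite -lnM ?posrE ?ltr0n ?skirting_num_gt0// -natrM.
rewrite ler_ln ?posrE ?ltr0n ?muln_gt0 ?skirting_num_gt0//.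
by rewrite ler_nat skirting_num_submult.
Qed.

Lemma has_lbound_skirting_root (R : realType) (q : nat) :
  has_lbound [set skirting_root R n q | n in [set n : nat | (1 <= n)%N]].
Proof. by exists 0 => _ [n _ <-]; exact: powR_ge0. Qed.

Lemma skirting_root_cvg_expR (R : realType) (q : nat) :
  skirting_root R n q @[n --> \oo] -->
    expR (inf [set (ln (skirting_num n q)%:R / n%:R : R)
               | n in [set n : nat | (1 <= n)%N]]).
Proof.
rewrite (_ : (fun n => _) = (fun n => expR (ln (skirting_num n q)%:R / n%:R))).
  by apply: continuous_cvg (@ln_skirting_num_cvg R q); exact: continuous_expR.
by apply/funext => n; rewrite skirting_rootE.
Qed.

(** One inequality holds because the infimum of the roots lies below their limit, the other because
    [expR] is increasing. *)
Lemma skirting_constE (R : realType) (q : nat) :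
  skirting_const R q =
    expR (inf [set (ln (skirting_num n q)%:R / n%:R : R)
               | n in [set n : nat | (1 <= n)%N]]).
Proof.
apply/eqP; rewrite eq_le; apply/andP; split.
  apply: (cvgr_to_ge (@skirting_root_cvg_expR R q)); near=> n.
  apply: ge_inf; first exact: has_lbound_skirting_root.
  by exists n => //=; near: n; exact: nbhs_infty_ge.
apply: lb_le_inf => [|_ [n n1 <-]].
  by exists (skirting_root R 1 q); exists 1%N.
rewrite skirting_rootE ler_expR; apply: ge_inf; last by exists n.
exists 0 => _ [k _ <-].
by rewrite divr_ge0// ln_ge0// ler1n skirting_num_gt0.
Unshelve. all: by end_near.
Qed.

Theorem theorem2p1 (R : realType) :
  (forall q : nat, (2 <= q)%N ->
     (skirting_root R n q @[n --> \oo] --> skirting_const R q) /\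
     (exists eps : nat -> R,
        is_little_o eps (fun _ : nat => 1) /\
        forall n : nat, (1 <= n)%N ->
          (skirting_num n q)%:R =
            skirting_const R q `^ ((1 + eps n) * n%:R))) /\
  (forall q q' : nat, (2 <= q)%N -> (q <= q')%N ->
     skirting_const R q' <= skirting_const R q).
Proof.
split=> [q q2|q q' q2 qq'].
  rewrite skirting_constE; split; first exact: skirting_root_cvg_expR.
  have cvgl := @ln_skirting_num_cvg R q.
  set l := inf _ in cvgl *.
  have l0 : 0 < l.
    have q'0 : (0 < q.-1)%N by rewrite -subn1 subn_gt0.
    apply: (@lt_le_trans _ _ (ln (q%:R / q.-1%:R))).
      by rewrite ln_gt0// ltr_pdivlMr ?ltr0n// mul1r ltr_nat ltn_predL ltnW.
    apply: lb_le_inf => [|_ [n n1 <-]]; last exact: ln_skirting_num_lower.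
    by exists (ln (skirting_num 1 q)%:R / 1%:R); exists 1%N.
  (* Taking logarithms, the required identity reads [ln f(n,q) = (1 + eps n) * n * l]; this is its
     solution, as [l] is nonzero. *)
  exists (fun n => ln (skirting_num n q)%:R / n%:R / l - 1); split.
    rewrite /is_little_o.
    under eq_fun do rewrite divr1.
    rewrite -(subrr 1) -[X in X - 1](@divff _ l) ?gt_eqF//.
    by apply: cvgB; [exact: cvgMl | exact: cvg_cst].
  (* [powR] treats base [0] separately; here the base is [expR l], and the factor [l] cancels in the
     exponent. *)
  move=> n n1; rewrite addrC subrK /powR gt_eqF ?expR_gt0// expRK.
  rewrite [X in expR X]mulrAC divfK ?gt_eqF//.
  by rewrite divfK ?pnatr_eq0 -?lt0n// lnK// posrE ltr0n skirting_num_gt0.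
(* Each root for [q] dominates the root for [q'] with the same [n], hence the constant of [q']. *)
apply: lb_le_inf => [|_ [n n1 <-]].
  by exists (skirting_root R 1 q); exists 1%N.
apply: (@le_trans _ _ (skirting_root R n q')).
  by apply: ge_inf; [exact: has_lbound_skirting_root | exists n].
rewrite !skirting_rootE ler_expR ler_pM2r ?invr_gt0 ?ltr0n//.
rewrite ler_ln ?posrE ?ltr0n ?skirting_num_gt0//.
by rewrite ler_nat skirting_num_anti.
Qed.
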